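(* Let $m\geq1$ be an integer and $p\in[0,1)$. As formal power series in $z$, the generating function of the distribution of $T_{m,p}$ is $$\sum_{n=0}^\infty\mathbb{P}(T_{m,p}\leq n)\,z^n=\left[(1-z)\sum_{\ell=0}^m\binom{m-m/z}{\ell}(-1)^\ell\left(\frac1{1-p}\right)^\ell\right]^{-1},$$ while the generating function of the tails is $$\sum_{n=0}^\infty\mathbb{P}(T_{m,p}>n)\,z^n=\frac1{1-z}-\left[(1-z)\sum_{\ell=0}^m\binom{m-m/z}{\ell}(-1)^\ell\left(\frac1{1-p}\right)^\ell\right]^{-1}.$$
   Context: For an integer $m\geq 1$, let $\{C_n\}_{n\geq 1}$ be uniformly distributed on $[m]=\{1,\dots,m\}$ and $\{U_n\}_{n\geq1}$ be uniformly distributed on $(0,1)$, with the whole family $\{U_n,C_n\}_{n\geq1}$ independent. For $i\in[m]$ and $n>0$ let $L(i,n)=\sup\{1\leq k\leq n : C_k=i\}$ (with $\sup\emptyset=-\infty$). For $p\in[0,1)$ the clumsy coupon collection time is $$T_{m,p}=\inf\{n>0 : L(i,n)>0 \text{ and } U_{L(i,n)}\leq 1-p \text{ for all } i\in[m]\}.$$ For an integer $\ell\geq0$, $\binom{z}{\ell}=\frac{1}{\ell!}z(z-1)\cdots(z-\ell+1)$ is a polynomial in $z$, with $\binom z0=1$. The bracketed expressions are rational functions of $z$ whose reciprocals are expanded as power series at $z=0$. *)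

(* Defs.v *)
From mathcomp Require Import all_boot all_order all_algebra finmap.
From mathcomp Require Import all_classical all_reals all_analysis.

Set Implicit Arguments.
Unset Strict Implicit.
Unset Printing Implicit Defensive.

Import Order.TTheory GRing.Theory Num.Theory.
Local Open Scope classical_set_scope.
Local Open Scope ring_scope.

Notation "x %:F" := (tofrac x) : ring_scope.

Section Probability.
Context {d : measure_display} {T : measurableType d} {R : realType}.
Variable P : probability T R.

Definition mutually_independent (I : choiceType) (D : set I)
    (G : I -> set (set T)) : Prop :=
  forall (J : {fset I}) (A : I -> set T),
    (forall i, i \in J -> D i /\ G i (A i)) ->
    P (\bigcap_(i in [set` J]) A i) = (\prod_(i <- J) P (A i))%E.

(* Sigma-algebras generated by the members of the joint family (U_n, C_n):
   [inl n] stands for U_n and [inr n] for C_n. *)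
Definition sigma_UC (U : nat -> T -> R) (C : nat -> T -> nat)
    (x : nat + nat) : set (set T) :=
  match x with
  | inl n => preimage_set_system setT (U n) measurable
  | inr n => preimage_set_system setT (C n) measurable
  end.

(* Sequences are indexed from 1: the terms of index 0 carry no assumption. *)
Definition index_UC : set (nat + nat) :=
  [set x | match x with inl n => (0 < n)%N | inr n => (0 < n)%N end].

Definition uniform01 (X : {RV P >-> R}) : Prop :=
  forall A : set R, measurable A ->
    distribution P X A = uniform_prob (@ltr01 R) A.

Definition uniform_range (m : nat) (X : {RV P >-> nat}) : Prop :=
  forall i : nat, (1 <= i <= m)%N -> distribution P X [set i] = (m%:R^-1)%:E.

End Probability.

Section CouponCollector.
Context {T : Type} {R : realType}.
Variables (U : nat -> T -> R) (C : nat -> T -> nat).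

(* L(i,n) = sup {1 <= k <= n : C_k = i}; the value for the empty set is 0
   instead of -oo, so that [0 < last_draw i n w] still says that the set is
   nonempty. *)
Definition last_draw (i n : nat) (w : T) : nat :=
  (\max_(1 <= k < n.+1 | C k w == i) k)%N.

(* The infimum is taken in the extended reals, so that it is +oo on the empty
   set. *)
Definition clumsy_time (m : nat) (p : R) (w : T) : \bar R :=
  ereal_inf [set (n%:R)%:E | n in [set n : nat | (0 < n)%N /\
    forall i : nat, (1 <= i <= m)%N ->
      (0 < last_draw i n w)%N /\ U (last_draw i n w) w <= 1 - p]].

End CouponCollector.

Definition gbinomial (K : fieldType) (z : K) (l : nat) : K :=
  (l`!%:R)^-1 * \prod_(k < l) (z - k%:R).

(* [expansion_at0 F a]: the rational function F is regular at 0 and the formal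
   power series \sum_n a_n z^n is its expansion there, i.e. F = N / D with
   D(0) != 0, and D * \sum_n a_n z^n = N (Cauchy product).  Such a sequence a
   is unique, and does not depend on the choice of N and D. *)
Definition expansion_at0 (K : fieldType) (F : {fraction {poly K}})
    (a : nat -> K) : Prop :=
  exists N D : {poly K},
    [/\ D.[0] != 0, F = N%:F / D%:F
      & forall n, \sum_(i < n.+1) D`_i * a (n - i)%N = N`_n].

Definition clumsy_bracket (R : realType) (m : nat) (p : R) :
    {fraction {poly R}} :=
  let z : {fraction {poly R}} := ('X : {poly R})%:F in
  (1 - z) * \sum_(l < m.+1) gbinomial (m%:R - m%:R / z) l
              * (-1) ^+ l * ((1 / (1 - p))%:P%:F) ^+ l.

(* Main.v *)
(** Put [q = 1 - p].  The set of coupons currently owned is a Markov chain whose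
    transitions depend only on its cardinality [k], and the function
    [g k = \sum_l 'C(k, l) / 'C(m, l) * binom (m - m/z) l * (-1/q)^l] satisfies
    [E (g (next state) | k) = g k / z] for [k < m], with [g 0 = 1].  Hence
    [z^n g(state_n)], stopped at the collection time [T], is a martingale; letting
    [n] grow, [1 = g m * \sum_n P(T = n) z^n], and [g m] is the sum in the bracket.
    Multiplying by [z^m] makes [g] polynomial in [z]. *)
Require Import Defs.
From mathcomp Require Import all_boot all_order all_algebra.
From mathcomp Require Import all_classical all_reals all_analysis.
From mathcomp Require Import finmap measurable_realfun ring.

Import Order.TTheory GRing.Theory Num.Theory.
Local Open Scope classical_set_scope.
Local Open Scope ring_scope.

Lemma tofrac_polyCV (K : fieldType) (c : K) : c != 0 ->
  (c^-1)%:P%:F = c%:P%:F^-1.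
Proof.
move=> c0; have cF0 : c%:P%:F != 0 by rewrite tofrac_eq0 polyC_eq0.
by apply: (mulIf cF0); rewrite mulVf // -!rmorphM /= mulVf.
Qed.

Lemma tofrac_natr (A : idomainType) (n : nat) : (n%:R : A)%:F = n%:R.
Proof. exact: rmorph_nat. Qed.

(** * The harmonic function of the chain, cleared of denominators *)

Section HarmonicPolynomials.
Context {R : realFieldType}.
Variables (m : nat) (q : R).
Hypothesis q0 : q != 0.

Definition harmonic_coef (l : nat) : {poly R} :=
  ((- q^-1) ^+ l / (m ^_ l)%:R) *:
    (\prod_(j < l) ((m%:R - j%:R) *: 'X - m%:R%:P) * 'X^(m - l)).

(* [harmonic_poly k] is [z^m * g k]: the falling factorial in [harmonic_coef]
   absorbs the [l`!] of the binomial coefficient together with ['C(m, l)]. *)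
Definition harmonic_poly (k : nat) : {poly R} :=
  \sum_(l < m.+1) harmonic_coef l *+ 'C(k, l).

(** Passing from [l] to [l.+1] multiplies the coefficient by [- q^-1 / (m - l)] and by
    [((m - l) X - m) / X]. This recurrence is what makes [harmonic_poly] harmonic. *)
Lemma harmonic_coefS l : (l < m)%N ->
  'X * ((m%:R - l%:R) *: (harmonic_coef l + q *: harmonic_coef l.+1)) =
  m%:R *: harmonic_coef l.
Proof.
move=> lm; rewrite /harmonic_coef.
have ml0 : m%:R - l%:R != 0 :> R by rewrite -natrB 1?ltnW // pnatr_eq0 subn_eq0 -ltnNge.
have mf0 : (m ^_ l)%:R != 0 :> R by rewrite pnatr_eq0 -lt0n ffact_gt0 ltnW.
rewrite big_ord_recr /= ffactnSr natrM natrB 1?ltnW // exprS.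
rewrite -[in 'X^(m - l)](subnSK lm) exprS.
set Q := \prod_(i < l) _; set Y := 'X^_; set f := (_)%:R in mf0 *.
set u := (- q^-1) ^+ l; set c := _ - _ in ml0 *.
rewrite -!mul_polyC !rmorphM /= !rmorphN /=.
(* In [{poly R}] the inverses of [m - l] and [q] are opaque constants, so [ring] receives their
   defining equations as hypotheses. *)
have := mulfV ml0 => /(congr1 polyC); rewrite rmorphM /= => h1.
have := mulfV q0 => /(congr1 polyC); rewrite rmorphM /= => h2.
rewrite invfM rmorphM /=.
move: h1 h2; set ci := (c^-1)%:P; set qi := (q^-1)%:P; rewrite polyC1 => h1 h2.
ring: h1 h2.
Qed.

Lemma harmonic_poly0 : harmonic_poly 0 = 'X^m.
Proof.
rewrite /harmonic_poly big_ord_recl big1 ?addr0 => [|l _].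
  by rewrite /harmonic_coef big_ord0 ffactn0 expr0 divr1 scale1r mul1r subn0.
by rewrite lift0 bin0n mulr0n.
Qed.

(** One step of the chain from [k] coupons, with probabilities scaled by [m]: the count stays when
    an owned coupon is accepted or a missing one rejected, rises when a missing one is accepted, and
    drops when an owned one is rejected. At [k = 0] the truncated [k.-1] carries weight 0. *)
Lemma harmonic_poly_step k : (k < m)%N ->
  'X * ((q * k%:R + (1 - q) * (m - k)%:R) *: harmonic_poly k
        + (q * (m - k)%:R) *: harmonic_poly k.+1
        + ((1 - q) * k%:R) *: harmonic_poly k.-1) =
  m%:R *: harmonic_poly k.
Proof.
move=> km; pose a (l : nat) : R := 'C(k, l)%:R.
(* Comparing the coefficients of each [harmonic_coef l] leaves only identities between binomials;
   the right-hand side is grouped to fit [harmonic_coefS]. *)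
have step0 : (q * k%:R + (1 - q) * (m - k)%:R) *: harmonic_poly k
    + (q * (m - k)%:R) *: harmonic_poly k.+1
    + ((1 - q) * k%:R) *: harmonic_poly k.-1 =
  \sum_(l < m.+1) ((m%:R - l%:R) * a l) *: harmonic_coef l
    + \sum_(l < m) ((m%:R - l%:R) * a l) *: (q *: harmonic_coef l.+1).
  rewrite [X in _ = _ + X](_ : _ = \sum_(l < m.+1)
     (if l == 0%N :> nat then 0
      else ((m%:R - l.-1%:R) * a l.-1 * q) *: harmonic_coef l)); last first.
    rewrite big_ord_recl /= add0r; apply: eq_bigr => l _.
    by rewrite /bump /= add1n scalerA.
  rewrite !scaler_sumr -!big_split /=; apply: eq_bigr => -[l lm] _ /=.
  rewrite natrB 1?ltnW // -!scaler_nat.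
  move: (harmonic_coef l) => h; rewrite !scalerA -!scalerDl.
  case: l lm => [|l] lm /=.
    rewrite addr0 /a !bin0; congr (_ *: _); ring.
  rewrite -scalerDl; congr (_ *: _).
  rewrite binS natrD -/(a l) -/(a l.+1).
  have h1 : k%:R * 'C(k.-1, l.+1)%:R = (k%:R - l.+1%:R) * a l.+1.
    rewrite -natrM mul_bin_down natrM -/(a _).
    have [lk|kl] := leqP l.+1 k; first by rewrite natrB.
    by rewrite /a bin_small // !mulr0.
  have h2 : l.+1%:R * a l.+1 = (k%:R - l%:R) * a l.
    rewrite -natrM mul_bin_left natrM -/(a _).
    have [lk|kl] := leqP l k; first by rewrite natrB.
    by rewrite /a bin_small // !mulr0.
  rewrite -[_ * _ * _%:R in LHS]mulrA h1.
  have l1 : l.+1%:R = l%:R + 1 :> R by rewrite -natr1.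
  have {}h2 : l%:R * a l.+1 = k%:R * a l - l%:R * a l - a l.+1.
    by apply/eqP; rewrite -mulrBl eq_sym subr_eq -h2 l1 mulrDl mul1r.
  rewrite l1; ring: h2.
(* The term [l = m] drops out: on the left by the factor [m - l], on the right because
   ['C(k, m) = 0] for [k < m]. *)
rewrite step0 big_ord_recr /= subrr mul0r scale0r addr0 -big_split /=.
rewrite mulr_sumr scaler_sumr big_ord_recr /= bin_small // mulr0n scaler0 addr0.
apply: eq_bigr => -[l lm] _ /=.
rewrite -scalerDr [_ * a l]mulrC -scalerA -scalerAr harmonic_coefS //.
by move: (harmonic_coef l) => h; rewrite -scaler_nat !scalerA mulrC.
Qed.

(** Terms with [l < m] keep a factor ['X^(m - l)], so at 0 only [l = m] survives, where every factor
    of the product is [- m]. This makes the expansion at 0 legitimate. *)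
Lemma harmonic_polym_at0 : (harmonic_poly m).[0] != 0.
Proof.
rewrite /harmonic_poly horner_sum big_ord_recr /= big1 ?add0r => [|l _].
  rewrite binn mulr1n /harmonic_coef subnn expr0 mulr1 hornerZ mulf_neq0 //.
    by rewrite mulf_neq0 ?expf_neq0 ?oppr_eq0 ?invr_neq0 // pnatr_eq0 -lt0n ffact_gt0.
  rewrite horner_prod; apply/prodf_neq0 => j _.
  rewrite !hornerE /= oppr_eq0.
  by rewrite pnatr_eq0 -lt0n (leq_trans _ (ltn_ord j)).
rewrite hornerMn hornerZ hornerM hornerXn expr0n subn_eq0 leqNgt ltn_ord.
by rewrite !mulr0 mul0rn.
Qed.

Let z : {fraction {poly R}} := ('X : {poly R})%:F.

Lemma gbinomial_harmonic l : (l <= m)%N ->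
  gbinomial (m%:R - m%:R / z) l * (-1) ^+ l * ((1 / q)%:P%:F) ^+ l * z ^+ m =
  (harmonic_coef l *+ 'C(m, l))%:F.
Proof.
move=> lm; rewrite div1r; have z0 : z != 0 by rewrite /z tofrac_eq0 polyX_eq0.
have -> : harmonic_coef l *+ 'C(m, l) = ((- q^-1) ^+ l * (l`!%:R)^-1) *:
    (\prod_(j < l) ((m%:R - j%:R) *: 'X - m%:R%:P) * 'X^(m - l)).
  rewrite /harmonic_coef -scaler_nat scalerA; congr (_ *: _).
  have l0 : l`!%:R != 0 :> R by rewrite pnatr_eq0 -lt0n fact_gt0.
  have C0 : 'C(m, l)%:R != 0 :> R by rewrite pnatr_eq0 -lt0n bin_gt0.
  rewrite -bin_ffact natrM; field.
  by rewrite C0 l0.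
rewrite -mul_polyC !rmorphM /= !rmorphXn /= !rmorphN /= rmorph_prod /=.
have -> : (l`!%:R^-1)%:P%:F = l`!%:R^-1 :> {fraction {poly R}}.
  have l0 : l`!%:R != 0 :> R by rewrite pnatr_eq0 -lt0n fact_gt0.
  by rewrite tofrac_polyCV // polyC_natr tofrac_natr.
(* Each of the [l] factors absorbs one [z], which clears its [m / z]. *)
have -> : \prod_(j < l) ((m%:R - j%:R) *: 'X - m%:R%:P : {poly R})%:F =
    (\prod_(j < l) (m%:R - m%:R / z - j%:R)) * z ^+ l.
  rewrite -[in z ^+ l](card_ord l) -prodr_const -big_split /=.
  apply: eq_bigr => j _; rewrite -mul_polyC !rmorphB /= rmorphM /= -/z.
  rewrite rmorphB /= !polyC_natr !tofrac_natr.
  by rewrite !mulrBl divfK // addrAC.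
rewrite /gbinomial [(- (q^-1)%:P%:F) ^+ l]exprNn -[in z ^+ m](subnKC lm) exprD -/z.
move: (l`!%:R^-1) (\prod_(_ < l) _) ((-1) ^+ l) (_%:F ^+ l) (z ^+ l) (z ^+ (m - l)).
by move=> a b c e f g; ring.
Qed.

(** At [k = m] the ratio of ['C(k, l)] to ['C(m, l)] is 1, so the sum in the bracket is [g m]. *)
Lemma sum_gbinomial_harmonic :
  \sum_(l < m.+1) gbinomial (m%:R - m%:R / z) l * (-1) ^+ l
      * ((1 / q)%:P%:F) ^+ l = (harmonic_poly m)%:F / z ^+ m.
Proof.
have z0 : z ^+ m != 0 by rewrite expf_neq0 // /z tofrac_eq0 polyX_eq0.
apply: (mulIf z0); rewrite divfK // mulr_suml rmorph_sum /=.
by apply: eq_bigr => -[l lm] _; rewrite gbinomial_harmonic.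
Qed.

End HarmonicPolynomials.

(** * The chain of owned coupons, on finite words of draws *)

Section Words.
Context {A : finType}.

(** Words grow on the right: the last letter is the latest draw, and summing over it amounts to
    conditioning on the past. *)
Fixpoint words (n : nat) : seq (seq A) :=
  if n is n'.+1 then [seq rcons e a | e <- words n', a <- enum A] else [:: [::]].

Lemma big_wordsS {V : nmodType} n (F : seq A -> V) :
  \sum_(e <- words n.+1) F e = \sum_(e <- words n) \sum_a F (rcons e a).
Proof. by rewrite big_allpairs_dep; apply: eq_bigr => e _; rewrite big_enum. Qed.

Lemma size_words n e : e \in words n -> size e = n.
Proof.
elim: n e => [|n IHn] e /=; first by rewrite inE => /eqP ->.
by case/allpairsP=> -[e' a] [/IHn <- _ ->]; rewrite size_rcons.
Qed.

End Words.

Section OwnedCoupons.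
Context {R : realFieldType}.
Variables (m : nat) (q : R).
Hypotheses (m0 : (0 < m)%N) (q0 : q != 0).
Local Notation letter := ('I_m * bool)%type.
Local Notation h := (harmonic_poly m q).

(** A letter records the coupon drawn and whether it was accepted. A rejected draw also loses an
    earlier accepted copy, since only the last draw of a coupon counts. *)
Definition update (S : {set 'I_m}) (a : letter) : {set 'I_m} :=
  (if a.2 then a.1 |: S else S :\ a.1)%SET.

Definition owned (e : seq letter) : {set 'I_m} := foldl update finset.set0 e.

(** [scanl] omits the initial state, in accordance with the condition [n > 0] in the collection
    time. *)
Definition completed (e : seq letter) : bool :=
  has (fun S : {set 'I_m} => #|S| == m) (scanl update finset.set0 e).

Lemma owned_rcons e a : owned (rcons e a) = update (owned e) a.
Proof. by rewrite /owned foldl_rcons. Qed.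

Lemma completed_rcons e a :
  completed (rcons e a) = completed e || (#|owned (rcons e a)| == m).
Proof. by rewrite /completed scanl_rcons has_rcons orbC. Qed.

Lemma owned_completed e : #|owned e| == m -> completed e.
Proof.
case/lastP: e => [|e a] em; last by rewrite completed_rcons em orbT.
by move: em; rewrite /owned /= cards0 eq_sym -leqn0 leqNgt m0.
Qed.

Definition letter_weight (a : letter) : R :=
  m%:R^-1 * (if a.2 then q else 1 - q).

Definition weight (e : seq letter) : R := \prod_(a <- e) letter_weight a.

Lemma weight_rcons e a : weight (rcons e a) = weight e * letter_weight a.
Proof. by rewrite /weight -cats1 big_cat big_seq1. Qed.

Lemma harmonic_update (S : {set 'I_m}) : #|S| != m ->
  'X * (\sum_a letter_weight a *: h #|update S a|) = h #|S|.
Proof.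
move=> Sm; have Sltm : (#|S| < m)%N.
  by rewrite ltn_neqAle Sm -[leqRHS](card_ord m) max_card.
have mR0 : m%:R != 0 :> R by rewrite pnatr_eq0 -lt0n.
apply: (can_inj (scalerK mR0)).
rewrite -harmonic_poly_step // scalerAr; congr ('X * _).
rewrite scaler_sumr.
rewrite -(pair_bigA _ (fun i b => m%:R *: (letter_weight (i, b) *: h #|update S (i, b)|))) /=.
(* The draws split into owned and missing coupons; within each class the summand depends only on
   [#|S|]. *)
rewrite (bigID (mem S)) /=.
rewrite (eq_bigr (fun=> q *: h #|S| + (1 - q) *: h #|S|.-1)); last first.
  move=> i iS; rewrite big_bool /update /letter_weight /= !scalerA !mulrA divff // !mul1r.
  by rewrite cardsU1 iS add0n [in #|S|.-1](cardsD1 i S) iS.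
rewrite [X in _ + X](eq_bigr (fun=> q *: h #|S|.+1 + (1 - q) *: h #|S|)); last first.
  move=> i iS; rewrite big_bool /update /letter_weight /= !scalerA !mulrA divff // !mul1r.
  by rewrite cardsU1 iS add1n; have := cardsD1 i S; rewrite (negbTE iS) add0n => <-.
rewrite !sumr_const (_ : #|fun i : 'I_m => i \notin S| = m - #|S|)%N; last first.
  by have := cardC (mem S); rewrite [RHS]card_ord => /(canRL (addKn _)) <-; apply: eq_card.
rewrite -!scaler_nat; move: (h #|S|) (h #|S|.+1) (h #|S|.-1) => h0 h1 h2.
rewrite -!mul_polyC !rmorphD !rmorphM /=.
ring.
Qed.

Lemma sum_letter_weight : \sum_a letter_weight a = 1.
Proof.
rewrite -(pair_bigA _ (fun i b => letter_weight (i, b))) /=.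
rewrite (eq_bigr (fun=> m%:R^-1)); last first.
  by move=> i _; rewrite big_bool /letter_weight /= -mulrDr addrC subrK mulr1.
by rewrite sumr_const card_ord -(mulr_natr m%:R^-1) mulVf // pnatr_eq0 -lt0n.
Qed.

Definition completion_cdf (n : nat) : R :=
  \sum_(e <- words n | completed e) weight e.

(** The part of the stopped martingale carried by the words that are not yet complete, without its
    factor [z^n]. *)
Definition residual (n : nat) : {poly R} :=
  \sum_(e <- words n | ~~ completed e) weight e *: h #|owned e|.

Lemma residual0 : residual 0 = 'X^m.
Proof.
rewrite /residual big_cons big_nil addr0 /weight big_nil scale1r.
by rewrite cards0 harmonic_poly0.
Qed.

Lemma completion_cdf0 : completion_cdf 0 = 0.
Proof. by rewrite /completion_cdf big_cons big_nil. Qed.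

(** Extensions of a completed word stay completed and keep its total weight, so they cancel in the
    increment of [completion_cdf]. For the other words [harmonic_update] applies, and the extensions
    that become complete contribute the term in [h m]. *)
Lemma residualS n :
  residual n =
  'X * (residual n.+1 + (completion_cdf n.+1 - completion_cdf n) *: h m).
Proof.
rewrite /residual /completion_cdf [LHS]big_mkcond [X in X + _]big_mkcond
  [X in X - _]big_mkcond [X in _ - X]big_mkcond !(big_wordsS n) -sumrB scaler_suml.
rewrite -big_split mulr_sumr; apply: eq_bigr => e _ /=.
have [ce|ce] := boolP (completed e).
  rewrite [X in X + _]big1 => [|a _]; last by rewrite completed_rcons ce.
  rewrite add0r (eq_bigr (fun a => weight e * letter_weight a)) => [|a _]; last first.
    by rewrite completed_rcons ce weight_rcons.
  by rewrite -mulr_sumr sum_letter_weight mulr1 subrr scale0r mulr0.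
rewrite subr0 scaler_suml -big_split /=.
rewrite (eq_bigr (fun a => weight e *: (letter_weight a *: h #|update (owned e) a|))).
  rewrite -scaler_sumr -scalerAr harmonic_update //.
  by apply: contra ce; apply: owned_completed.
move=> a _; rewrite completed_rcons (negPf ce) /= owned_rcons scalerA weight_rcons.
case: eqP => [->|_]; first by rewrite add0r.
by rewrite scale0r addr0.
Qed.

(* The stopped martingale identity at time [n]; the last two terms on the right
   are multiples of ['X^n], so they do not affect lower coefficients. *)
Lemma completion_cdf_gf n :
  (1 - 'X) * h m * (\sum_(j < n.+1) completion_cdf j *: 'X^j) =
  'X^m - 'X^n * residual n - completion_cdf n *: ('X^(n.+1) * h m).
Proof.
elim: n => [|n IHn].
  rewrite big_ord1 completion_cdf0 !scale0r mulr0 subr0 residual0.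
  by rewrite expr0 mul1r subrr.
rewrite big_ord_recr mulrDr IHn (residualS n) /= -!mul_polyC polyCB !exprS.
by ring.
Qed.

End OwnedCoupons.

(** * From polynomial identities to power series *)

(** Degree [n] of a product sees only the first [n.+1] terms of the series, so Cauchy products can
    be read off polynomials. *)
Lemma coef_mul_truncation (R : comNzRingType) (D : {poly R}) (a : nat -> R)
    (n N : nat) : (n < N)%N ->
  (D * (\sum_(j < N) a j *: 'X^j))`_n = \sum_(i < n.+1) D`_i * a (n - i)%N.
Proof.
move=> nN; rewrite coefM; apply: eq_bigr => i _; congr (_ * _).
rewrite -[\sum_(j < N) _](poly_def N a) coef_poly.
by rewrite (leq_ltn_trans (leq_subr _ _) nN).
Qed.

Lemma expansion_completion_cdf (R : realType) (m : nat) (p : R) :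
  (0 < m)%N -> p < 1 ->
  let c := completion_cdf m (1 - p) in
  expansion_at0 (clumsy_bracket m p)^-1 c /\
  expansion_at0 ((1 - ('X : {poly R})%:F)^-1 - (clumsy_bracket m p)^-1)
    (fun n => 1 - c n).
Proof.
move=> m0 p1 c; have q0 : 1 - p != 0 by rewrite subr_eq0 eq_sym lt_eqF.
pose D := (1 - 'X) * harmonic_poly m (1 - p) m.
have D0 : D.[0] != 0.
  by rewrite hornerM !hornerE subr0 mul1r harmonic_polym_at0.
have DF0 : D%:F != 0.
  by rewrite tofrac_eq0; apply: contraNneq D0 => ->; rewrite horner0.
have X1F0 : 1 - 'X%:F != 0 :> {fraction {poly R}}.
  move: DF0; rewrite /D rmorphM rmorphB /= => DF0.
  by apply: contraNneq DF0 => ->; rewrite mul0r.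
have bracketV : (clumsy_bracket m p)^-1 = 'X^m%:F / D%:F.
  rewrite /clumsy_bracket /= sum_gbinomial_harmonic // mulrA invf_div.
  by rewrite /D rmorphM rmorphB rmorphXn.
have cauchy n : \sum_(i < n.+1) D`_i * c (n - i)%N = ('X^m : {poly R})`_n.
  (* Truncating after degree [n.+1] puts the error terms of [completion_cdf_gf] in degrees above
     [n]. *)
  rewrite -(coef_mul_truncation _ _ _ _ _ (leqnSn n.+1)) completion_cdf_gf //.
  by rewrite !coefB coefZ !coefXnM ltnS leqnn ltnS leqnSn mulr0 !subr0.
split; first by exists 'X^m, D; split.
(* Over the common denominator [D], the fraction [1 / (1 - z)] has numerator
   [harmonic_poly m (1 - p) m]. *)
exists (harmonic_poly m (1 - p) m - 'X^m), D; split=> //.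
  rewrite bracketV rmorphB mulrBl; congr (_ - _).
  move: DF0; rewrite /D rmorphM rmorphB /= => DF0.
  have invfE (K : fieldType) (x y : K) : y != 0 -> x^-1 = y / (x * y).
    by move=> y0; rewrite invfM mulrCA divff ?mulr1.
  apply: invfE; by apply: contraNneq DF0 => ->; rewrite mulr0.
move=> n; under eq_bigr do rewrite mulrBr mulr1.
rewrite sumrB cauchy coefB; congr (_ - _).
rewrite [LHS](eq_bigr (fun i : 'I_n.+1 => D`_i * 1)) => [|i _]; last by rewrite mulr1.
rewrite -(coef_mul_truncation _ _ (fun=> 1) _ _ (ltnSn n)).
rewrite (eq_bigr (fun i : 'I_n.+1 => 'X^i)) => [|i _]; last by rewrite scale1r.
rewrite /D mulrAC.
have -> : (1 - 'X) * (\sum_(i < n.+1) 'X^i) = 1 - 'X^(n.+1) :> {poly R}.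
  by rewrite -opprB mulNr -subrX1 opprB.
by rewrite mulrBl mul1r coefB coefXnM ltnSn subr0.
Qed.

(** * Tools for the collection time and for finite unions *)

(** An infimum at most [n] is below [n.+1], hence so is some member; being a natural number, that
    member is at most [n]. *)
Lemma ereal_inf_natP (R : realType) (A : set nat) (n : nat) :
  (ereal_inf [set (k%:R : R)%:E | k in A] <= (n%:R : R)%:E)%E <->
  exists2 k, (k <= n)%N & A k.
Proof.
split=> [infn|[k kn Ak]]; last first.
  apply: (@le_trans _ _ (k%:R : R)%:E); last by rewrite lee_fin ler_nat.
  by apply: ereal_inf_lbound; exists k.
have : (ereal_inf [set (k%:R : R)%:E | k in A] < (n.+1%:R : R)%:E)%E.
  by rewrite (le_lt_trans infn) // lte_fin ltr_nat.
case/ereal_inf_lt => _ [k Ak <-]; rewrite lte_fin ltr_nat ltnS => kn.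
by exists k.
Qed.

Lemma last_drawS (T : Type) (C : nat -> T -> nat) (i n : nat) (w : T) :
  last_draw C i n.+1 w = if C n.+1 w == i then n.+1 else last_draw C i n w.
Proof.
rewrite /last_draw big_mkcond big_nat_recr //= -big_mkcond.
case: ifP => _; last by rewrite maxn0.
apply/maxn_idPr/bigmax_leqP_seq => k.
by rewrite mem_index_iota => /andP[_ kn] _; rewrite ltnW.
Qed.

Lemma measure_bigcup_fin {d : measure_display} {T : measurableType d}
    {R : realType} (mu : {measure set T -> \bar R}) (I : finType) (F : I -> set T) :
  (forall i, measurable (F i)) -> trivIset setT F ->
  mu (\bigcup_i F i) = (\sum_i mu (F i))%E.
Proof.
move=> mF tF; rewrite measure_fin_bigcup //; last exact: finite_finset.
rewrite (fsbigE (enum I)) ?enum_uniq // => [|i _]; last by rewrite mem_enum.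
by rewrite big_enum_cond; apply: eq_bigl => i; rewrite in_setT andbT.
Qed.

(** * Law of the draws, and transfer from words to events *)

Section Draws.
Context {d : measure_display} {Omega : measurableType d} {R : realType}.
Variables (P : probability Omega R) (m : nat) (p : R).
Variables (U : nat -> {RV P >-> R}) (C : nat -> {RV P >-> nat}).
Hypotheses (hm : (1 <= m)%N) (hp : 0 <= p < 1).
Hypothesis hU : forall n : nat, (1 <= n)%N -> uniform01 (U n).
Hypothesis hC : forall n : nat, (1 <= n)%N -> uniform_range m (C n).
Hypothesis hUC : mutually_independent P index_UC (sigma_UC U C).
Local Notation letter := ('I_m * bool)%type.
Local Notation q := (1 - p).

Definition kept (i n : nat) (w : Omega) : Prop :=
  (0 < last_draw C i n w)%N /\ U (last_draw C i n w) w <= q.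

Definition kept_all (n : nat) (w : Omega) : Prop :=
  forall i : nat, (1 <= i <= m)%N -> kept i n w.

Lemma clumsy_time_leP n w :
  (clumsy_time U C m p w <= n%:R%:E)%E <->
  exists2 k, (0 < k <= n)%N & kept_all k w.
Proof.
rewrite /clumsy_time ereal_inf_natP; split=> [[k kn [k0 kw]]|[k /andP[k0 kn] kw]].
  by exists k => //; rewrite k0.
by exists k.
Qed.

Lemma keptS i n w :
  kept i n.+1 w <-> if C n.+1 w == i then (U n.+1 w <= q : Prop) else kept i n w.
Proof.
rewrite /kept last_drawS; case: ifP => // _.
by split=> [[]|].
Qed.

Lemma measurable_kept i n : measurable [set w | kept i n w].
Proof.
elim: n => [|n IHn].
  rewrite (_ : [set w | _] = set0) // -subset0 => w [].
  by rewrite /last_draw big_nil.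
rewrite (_ : [set w | _] =
  (C n.+1 @^-1` [set i] `&` U n.+1 @^-1` `]-oo, q]) `|`
  (C n.+1 @^-1` (~` [set i]) `&` [set w | kept i n w])).
  by apply: measurableU; apply: measurableI => //; apply: measurable_funPTI.
apply/seteqP; split=> w /=; rewrite keptS in_itv /=; case: eqP => Ci; tauto.
Qed.

Lemma measurable_kept_all n : measurable [set w | kept_all n w].
Proof.
rewrite (_ : [set w | _] = \bigcap_(i in [set i | (1 <= i <= m)%N]) [set w | kept i n w]) //.
by apply: bigcap_measurableType => i _; apply: measurable_kept.
Qed.

Definition accept (b : bool) : set R := [set x | (x <= q) = b].

Lemma measurable_accept b : measurable (accept b).
Proof.
case: b.
  by rewrite (_ : accept _ = `]-oo, q]%classic) //; apply/seteqP; split=> x /=; rewrite in_itv.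
rewrite (_ : accept _ = ~` `]-oo, q]%classic); first exact: measurableC.
by apply/seteqP; split=> x /=; rewrite in_itv /= => /negP; rewrite /accept /=; case: (x <= q).
Qed.

Lemma uniform_prob_accept b :
  uniform_prob (@ltr01 R) (accept b) = (if b then q else 1 - q)%:E.
Proof.
have /andP[p0 p1] := hp.
have acceptT : uniform_prob (@ltr01 R) (accept true) = q%:E.
  have mA := measurable_accept true.
  (* The uniform probability is computed as the integral of an indicator, which reduces it to the
     Lebesgue measure of [[0, q]]; here [0 <= p] gives [q <= 1]. *)
  rewrite -(setIT (accept true)) -integral_indic // integral_uniform //; last first.
    exact/measurable_EFinP/measurable_indic.
  rewrite subr0 invr1 mul1e integral_indic //.
  rewrite (_ : accept true `&` _ = `[0, q]%classic).
    apply: etrans (lebesgue_measure_itv `[0, q]) _.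
    by rewrite /= lte_fin subr_gt0 p1 oppr0 adde0.
  apply/seteqP; split=> x /=; rewrite /accept /= !in_itv /=.
    by move=> [-> /andP[-> _]].
  by move=> /andP[x0 xq]; rewrite x0 xq (le_trans xq) // lerBlDr lerDl.
case: b => //.
rewrite (_ : accept false = ~` accept true).
  apply: etrans (probability_setC (uniform_prob (@ltr01 R)) (measurable_accept true)) _.
  by rewrite [X in (_ - X)%E]acceptT.
by apply/seteqP; split=> x /=; rewrite /accept /=; case: (x <= q).
Qed.

(** Ordinals start at 0 and coupons at 1, hence the successor. *)
Definition drawn (n : nat) (a : letter) : set Omega :=
  C n @^-1` [set a.1.+1] `&` U n @^-1` accept a.2.

Lemma measurable_drawn n a : measurable (drawn n a).
Proof.
by apply: measurableI; apply: measurable_funPTI => //; apply: measurable_accept.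
Qed.

Lemma drawn_prob (f : nat -> letter) (n : nat) :
  P (\bigcap_(j in `I_n) drawn j.+1 (f j)) =
  (\prod_(j < n) letter_weight m q (f j))%:E.
Proof.
pose A (x : nat + nat) : set Omega := match x with
  | inl j => U j @^-1` accept (f j.-1).2
  | inr j => C j @^-1` [set (f j.-1).1.+1] end.
(* [J n] holds the indices 1 to [n] of both sequences; its recursive form lets the product given by
   independence be peeled off two factors at a time. *)
pose fix J (n : nat) : {fset nat + nat} :=
  (if n is k.+1 then inl n |` (inr n |` J k) else fset0)%fset.
have memJ : forall k x, (x \in J k) =
    match x with inl j | inr j => (0 < j <= k)%N end.
  elim=> [|k IHk] x /=; first by case: x => [[]|[]].
  rewrite !in_fset1U IHk; case: x => -[|j]; rewrite ?orbF //= /eq_op /=.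
    by rewrite [RHS]leq_eqVlt /eq_op /=.
  by rewrite [RHS]leq_eqVlt /eq_op /=.
have capJ : \bigcap_(j in `I_n) drawn j.+1 (f j) = \bigcap_(x in [set` J n]) A x.
  apply/seteqP; split=> w /= h.
    by move=> [[|j]|[|j]] /=; rewrite memJ //= => jn; have [] := h j jn.
  by move=> j /= jn; split; [have := h (inr j.+1)|have := h (inl j.+1)];
    apply=> /=; rewrite memJ.
rewrite capJ hUC; last first.
  move=> [[|j]|[|j]]; rewrite memJ //= => jn; split=> //.
    by exists (accept (f j).2); [exact: measurable_accept|rewrite setTI].
  by exists [set (f j).1.+1]; [|rewrite setTI].
elim: n {capJ} => [|n IHn]; first by rewrite big_seq_fset0 big_ord0.
rewrite /= big_fsetU1 ?in_fset1U ?memJ ?ltnn ?andbF //=.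
rewrite big_fsetU1 ?memJ ?ltnn ?andbF //= IHn big_ord_recr /= muleA muleC EFinM.
congr (_ * _)%E.
have := hU n.+1 isT _ (measurable_accept (f n).2).
rewrite /distribution /pushforward /= => ->; rewrite uniform_prob_accept.
have := hC n.+1 isT (f n).1.+1; rewrite ltn_ord /distribution /pushforward /= => -> //.
by rewrite muleC.
Qed.

Lemma trivIset_drawn n : trivIset setT (drawn n).
Proof.
move=> [i b] [j c] _ _ [w [[/= Ci Ub] [/= Cj Uc]]].
by move: Ub Uc; rewrite /accept /= => <- <-; move: Cj; rewrite Ci => -[/val_inj ->].
Qed.

(** The [m] point masses [1 / m] already sum to 1, so a draw outside [1..m] has probability 0. *)
Lemma drawn_cover_prob n : P (\bigcup_a drawn n.+1 a) = 1%E.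
Proof.
rewrite (_ : \bigcup_a _ = \bigcup_(i : 'I_m) C n.+1 @^-1` [set i.+1]).
  rewrite measure_bigcup_fin; first last.
  - by move=> i j _ _ [w [/= -> [/val_inj]]].
  - by move=> i; apply: measurable_funPTI.
  rewrite (eq_bigr (fun=> m%:R^-1%:E)) => [|i _].
    by rewrite sumEFin sumr_const card_ord -(mulr_natr m%:R^-1) mulVf // pnatr_eq0 -lt0n.
  by have := hC n.+1 isT i.+1; rewrite /distribution /pushforward ltn_ord; apply.
apply/seteqP; split=> w /=.
  by move=> [a _ [Ca _]]; exists a.1.
by move=> [i _ Ci]; exists (i, U n.+1 w <= q).
Qed.

(** The events [drawn n.+1 a] are disjoint but cover the space only up to a null set, so the part of
    [B] outside them is discarded by measure. *)
Lemma prob_draw_decomposition n (B : set Omega) : measurable B ->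
  P B = (\sum_a P (B `&` drawn n.+1 a))%E.
Proof.
move=> mB; have mD : measurable (\bigcup_a drawn n.+1 a).
  by apply: fin_bigcup_measurable => // a _; apply: measurable_drawn.
have nullD : P (B `\` \bigcup_a drawn n.+1 a) = 0%E.
  apply: (@subset_measure0 _ _ _ P _ (~` (\bigcup_a drawn n.+1 a))).
  - exact: measurableD.
  - exact: measurableC.
  - by move=> w [].
  - by apply: etrans (probability_setC P mD) _; rewrite drawn_cover_prob subee.
rewrite (measureDI P mB mD) [X in (X + _)%E]nullD add0e.
rewrite setI_bigcupr; apply: measure_bigcup_fin => [a|].
  by apply: measurableI => //; apply: measurable_drawn.
by apply: trivIset_setIl; apply: trivIset_drawn.
Qed.

Let a0 : letter := (Ordinal hm, true).

(** Letter [j] describes draw [j.+1]. The default [a0] is never read, as [j] stays below the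
    size. *)
Definition path_event (e : seq letter) : set Omega :=
  \bigcap_(j in `I_(size e)) drawn j.+1 (nth a0 e j).

Lemma path_event_rcons e a :
  path_event (rcons e a) = path_event e `&` drawn (size e).+1 a.
Proof.
apply/seteqP; split=> w /=; rewrite /path_event size_rcons.
  move=> h; split=> [j /= je|]; last first.
    by have := h (size e) (ltnSn _); rewrite nth_rcons ltnn eqxx.
  by have := h j (ltnW je); rewrite nth_rcons je.
move=> [h1 h2] j /=; rewrite ltnS leq_eqVlt => /orP[/eqP ->|je].
  by rewrite nth_rcons ltnn eqxx.
by rewrite nth_rcons je; apply: h1.
Qed.

Lemma path_event_prob e : P (path_event e) = (weight m q e)%:E.
Proof.
rewrite /path_event drawn_prob /weight; congr (_%:E).
by rewrite (big_nth a0) big_mkord.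
Qed.

Lemma measurable_path_event e : measurable (path_event e).
Proof. by apply: bigcap_measurableType => j _; apply: measurable_drawn. Qed.

Lemma prob_path_decomposition n (B : set Omega) : measurable B ->
  P B = (\sum_(e <- words n) P (B `&` path_event e))%E.
Proof.
move=> mB; elim: n => [|n IHn].
  rewrite big_seq1 /path_event (_ : `I_0 = set0) ?bigcap_set0 ?setIT //.
  by rewrite -subset0 => j.
rewrite (big_wordsS n) IHn !big_seq; apply: eq_bigr => e /size_words en.
rewrite (prob_draw_decomposition n); last first.
  by apply: measurableI => //; apply: measurable_path_event.
by apply: eq_bigr => a _; rewrite path_event_rcons en setIA.
Qed.

(** On a path event the word fixes the outcome of the last draw of each coupon. Induction on the
    last letter matches [keptS] with [update]. *)
Lemma kept_owned e w (i : 'I_m) : path_event e w ->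
  kept i.+1 (size e) w <-> i \in owned m e.
Proof.
elim/last_ind: e => [_|e a IHe].
  by rewrite /owned /= finset.in_set0 /kept /last_draw big_nil; split=> [[]|].
rewrite path_event_rcons => -[/IHe {}IHe [Ca]].
rewrite size_rcons keptS Ca owned_rcons /update /accept /= => ->.
rewrite eqSS -[_ == _]/(a.1 == i) eq_sym.
by case: a.2; rewrite ?finset.in_setU1 ?finset.in_setD1; case: eqP.
Qed.

Lemma kept_all_owned e w : path_event e w ->
  kept_all (size e) w <-> #|owned m e| == m.
Proof.
move=> ew; split=> [h|/eqP em i /andP[]].
  suff -> : owned m e = [set: 'I_m]%SET by rewrite cardsT card_ord.
  apply/finset.setP => i; rewrite finset.in_setT.
  by apply/(kept_owned _ _ _ ew)/h; rewrite /= ltn_ord.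
case: i => // i _ im.
rewrite -[i]/(val (Ordinal im)) (kept_owned _ _ _ ew).
suff -> : owned m e = [set: 'I_m]%SET by rewrite finset.in_setT.
by apply/eqP; rewrite eqEcard finset.subsetT cardsT card_ord em /=.
Qed.

Lemma kept_completed e w : path_event e w ->
  (exists2 k, (0 < k <= size e)%N & kept_all k w) <-> completed m e.
Proof.
elim/last_ind: e => [_|e a IHe ew].
  by split=> // -[[]].
have := ew; rewrite path_event_rcons => -[/IHe {}IHe _].
rewrite completed_rcons size_rcons; split.
  move=> [k /andP[k0]]; rewrite leq_eqVlt => /orP[/eqP ->|ke] hk.
    by apply/orP; right; apply/(kept_all_owned _ _ ew); rewrite size_rcons.
  by apply/orP; left; apply/IHe; exists k => //; rewrite k0.
case/orP=> [/IHe[k /andP[k0 ke] hk]|/(kept_all_owned _ _ ew)].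
  by exists k => //; rewrite k0 ltnW.
by rewrite size_rcons => hk; exists (size e).+1; rewrite ?ltnSn.
Qed.

Lemma measurable_clumsy_time_le n :
  measurable [set w | (clumsy_time U C m p w <= n%:R%:E)%E].
Proof.
rewrite (_ : [set w | _] = \bigcup_(k in [set k | (0 < k <= n)%N]) [set w | kept_all k w]).
  by apply: bigcup_measurable => k _; apply: measurable_kept_all.
by apply/seteqP; split=> w /=; rewrite clumsy_time_leP => -[k kn kw]; exists k.
Qed.

(** On the path event of a word of length [n], the event [T <= n] holds everywhere or nowhere,
    according to [completed]; the weights of the completed words therefore add up to its
    probability. *)
Lemma clumsy_time_cdf n :
  P [set w | (clumsy_time U C m p w <= n%:R%:E)%E] = (completion_cdf m q n)%:E.
Proof.
rewrite (prob_path_decomposition n) ?/completion_cdf; last exact: measurable_clumsy_time_le.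
rewrite -sumEFin [RHS]big_mkcond !big_seq; apply: eq_bigr => e /size_words en.
rewrite -path_event_prob; case: ifP => ce.
  congr (P _); apply/setIidPr => w ew /=.
  by rewrite clumsy_time_leP -en (kept_completed _ _ ew).
rewrite (_ : _ `&` _ = set0) ?measure0 // -subset0 => w [/= hw ew].
by move: hw; rewrite clumsy_time_leP -en (kept_completed _ _ ew) ce.
Qed.

End Draws.

Theorem corollary3p10 (d : measure_display) (Omega : measurableType d)
    (R : realType) (P : probability Omega R) (m : nat) (p : R)
    (U : nat -> {RV P >-> R}) (C : nat -> {RV P >-> nat})
    (hm : (1 <= m)%N) (hp : 0 <= p < 1)
    (hU : forall n : nat, (1 <= n)%N -> uniform01 (U n))
    (hC : forall n : nat, (1 <= n)%N -> uniform_range m (C n))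
    (hUC : mutually_independent P index_UC (sigma_UC U C)) :
  expansion_at0 (clumsy_bracket m p)^-1
    (fun n : nat =>
       fine (P [set w | (clumsy_time U C m p w <= n%:R%:E)%E]))
  /\
  expansion_at0 ((1 - ('X : {poly R})%:F)^-1 - (clumsy_bracket m p)^-1)
    (fun n : nat =>
       fine (P [set w | (n%:R%:E < clumsy_time U C m p w)%E])).
Proof.
have /andP[_ p1] := hp.
have cdfE n := clumsy_time_cdf P m p U C hm hp hU hC hUC n.
have [h1 h2] := expansion_completion_cdf _ _ _ hm p1.
split.
  rewrite (_ : (fun n => _) = completion_cdf m (1 - p)) //.
  by apply/funext => n; rewrite cdfE.
rewrite (_ : (fun n => _) = fun n => 1 - completion_cdf m (1 - p) n) //.
apply/funext => n.
(* The tail event is the complement of the event just treated, so its probability is 1 minus the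
   distribution function. *)
rewrite (_ : [set w | _] = ~` [set w | (clumsy_time U C m p w <= n%:R%:E)%E]).
  rewrite probability_setC ?cdfE //.
  exact: measurable_clumsy_time_le.
by apply/seteqP; split=> w /=; rewrite ltNge => /negP.
Qed.
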